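(* Let $\mathcal{F}$ be a family of finite subsets of $\mathbb{N}$. Then for every countable ordinal $\xi$, every infinite subset $M$ of $\mathbb{N}$ and every $\xi$-uniform family $\mathcal{L}$ on $M$ there exists an infinite subset $L$ of $M$ such that either $\mathcal{L}\cap[L]^{<\omega}\subseteq\mathcal{F}$ or $\mathcal{L}\cap[L]^{<\omega}\subseteq[M]^{<\omega}\setminus\mathcal{F}$.
   Context: $\mathbb{N}=\{1,2,3,\dots\}$. For an infinite $M\subseteq\mathbb{N}$, $[M]^{<\omega}$ is the set of all finite subsets of $M$ and $[M]$ the set of all infinite subsets of $M$. For finite sets, $s<t$ means $\max s<\min t$ (vacuously true if one of them is empty). Uniform families. Let $M\in[\mathbb{N}]$ and $\mathcal{L}\subseteq[M]^{<\omega}$. For $m\in M$ put $\mathcal{L}(m)=\{s\in[M]^{<\omega}:\{m\}\cup s\in\mathcal{L}\text{ and }\{m\}<s\}$. For countable ordinals $\xi$, ''$\mathcal{L}$ is $\xi$-uniform on $M$'' is defined recursively: (1) $\mathcal{L}$ is $0$-uniform on $M$ if $\mathcal{L}=\{\emptyset\}$; (2) if $\xi=\zeta+1$, $\mathcal{L}$ is $\xi$-uniform on $M$ if $\emptyset\notin\mathcal{L}$ and $\mathcal{L}(m)$ is $\zeta$-uniform on $M\cap(m,+\infty)$ for every $m\in M$; (3) if $\xi$ is a nonzero limit ordinal, $\mathcal{L}$ is $\xi$-uniform on $M$ if $\emptyset\notin\mathcal{L}$ and there is an increasing sequence $(\xi_m)_{m\in M}$ of ordinals smaller than $\xi$ with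 $\sup_m\xi_m=\xi$ such that $\mathcal{L}(m)$ is $\xi_m$-uniform on $M\cap(m,+\infty)$ for every $m\in M$. *)

(* Defs.v *)
From HB Require Import structures.
From mathcomp Require Import all_boot all_order finmap.
From mathcomp Require Import boolp classical_sets functions cardinality.

Set Implicit Arguments.
Unset Strict Implicit.
Unset Printing Implicit Defensive.

Local Open Scope classical_set_scope.

Definition posnat : set nat := [set n | 0 < n].

(* [M]^{<omega} *)
Definition finsubsets (M : set nat) : set {fset nat} :=
  [set s | [set` s] `<=` M].

(* L(m), computed relatively to the ambient set M. *)
Definition link (M : set nat) (L : set {fset nat}) (m : nat) :
    set {fset nat} :=
  [set s | [/\ finsubsets M s, L (m |` s)%fset
             & forall k, k \in s -> m < k]].

Definition above (M : set nat) (m : nat) : set nat :=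
  M `&` [set k | m < k].

(* An ordinal is represented by an element xi of a well-ordered type W: it is
   the order type of {eta : W | eta < xi}. The notions below depend only on
   that initial segment, and every ordinal is of this form (for instance in
   its own successor), so quantifying over all W and all xi is quantifying
   over all ordinals. *)
Section Ordinals.
Context {d : Order.disp_t} {W : orderType d}.
Implicit Types xi zeta eta : W.

Local Open Scope order_scope.

Definition well_ordered_type : Prop := well_founded (fun eta xi : W => eta < xi).

Definition countable_ordinal xi : Prop := countable [set eta | eta < xi].

Definition is_zero xi : Prop := forall eta, xi <= eta.

Definition is_succ zeta xi : Prop :=
  zeta < xi /\ forall eta, zeta < eta -> xi <= eta.

Definition is_limit xi : Prop :=
  ~ is_zero xi /\ ~ exists zeta, is_succ zeta xi.

(* The recursion on xi is rendered inductively; when W is well-ordered exactly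
   one of the three clauses applies to each xi. Only the values of x on M
   matter in the limit clause. *)
Inductive uniform : W -> set nat -> set {fset nat} -> Prop :=
| uniform_zero xi M L :
    is_zero xi -> L = [set fset0] -> uniform xi M L
| uniform_succ xi zeta M L :
    is_succ zeta xi -> ~ L fset0 ->
    (forall m, M m -> uniform zeta (above M m) (link M L m)) ->
    uniform xi M L
| uniform_limit xi (x : nat -> W) M L :
    is_limit xi -> ~ L fset0 ->
    (forall m n, M m -> M n -> (m < n)%N -> x m < x n) ->
    (forall m, M m -> x m < xi) ->
    supremums (x @` M) xi ->
    (forall m, M m -> uniform (x m) (above M m) (link M L m)) ->
    uniform xi M L.

End Ordinals.

Arguments well_ordered_type {d} W.

(* Main.v *)
Require Import Defs.
From HB Require Import structures.
From mathcomp Require Import all_boot all_order finmap.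
From mathcomp Require Import boolp classical_sets functions cardinality.

(** The theorem is a Ramsey theorem of Nash-Williams type. It holds because a
nonempty finite set is its least element [m] followed by a tail above [m]: if
[C] does not contain the empty set, then deciding whether members of [C] lie
in [F] amounts to deciding, for each [m], whether the members [t] of the link
[C(m)] satisfy [F (m |` t)]. The links of a uniform family are uniform of
smaller rank, so one can argue by induction along the definition of
uniformity.

In the inductive step ([ramsey_on_links]), the induction hypothesis homogenises
[C(m)] for one [m] at a time. A diagonalisation ([diagonal_intersection]) treats
all [m] at once: it yields an infinite set [D] such that for each [m] in [D] all
the members of [C(m)] made of elements of [D] above [m] fall on the same side.
That side is a two-colouring of [D]; on an infinite monochromatic subset of [D]
the whole of [C] falls on one side ([sub_of_links]).

The successor and limit clauses go through the same step, since its
only input is the Ramsey property of each link. *)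

Local Open Scope classical_set_scope.

Definition homogeneous (C F : set {fset nat}) (N : set nat) : Prop :=
  C `&` finsubsets N `<=` F \/ C `&` finsubsets N `<=` ~` F.

(** The infinite set [N] is arbitrary inside [M], rather than equal to [M], so
that the property can be applied again inside the successive reservoirs of a
diagonalisation. This spares a proof that uniformity is inherited by infinite
subsets of [M]. *)
Definition ramsey_on (M : set nat) (C : set {fset nat}) : Prop :=
  forall (F : set {fset nat}) (N : set nat), N `<=` M -> infinite_set N ->
    exists L : set nat, [/\ L `<=` N, infinite_set L & homogeneous C F L].

Lemma homogeneousS (C F : set {fset nat}) (A B : set nat) :
  B `<=` A -> homogeneous C F A -> homogeneous C F B.
Proof.
move=> sBA [hA|hA]; [left|right] => s [Cs sB]; apply: hA; split=> //;
  exact: subset_trans sB sBA.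
Qed.

Lemma infinite_above (N : set nat) (m : nat) :
  infinite_set N -> infinite_set (above N m).
Proof.
move=> infN; have := infinite_setD infN (finite_II m.+1).
by apply: sub_infinite_set => k [Nk /negP]; rewrite -leqNgt.
Qed.

(** Any property [Q m] of infinite sets that passes to subsets and can be
achieved by shrinking, for each single [m], can be achieved for all [m] of one
infinite [L] simultaneously. One picks [x_0 < x_1 < ...] and reservoirs
[A_0 `>=` A_1 `>=` ...] with [x_(n+1)] in [A_n] and [Q x_n A_n]; the elements of
[L] above [x_n] are later choices, hence all lie in [A_n]. *)
Lemma diagonal_intersection (Q : nat -> set nat -> Prop) (N : set nat) :
  (forall m A B, B `<=` A -> Q m A -> Q m B) ->
  infinite_set N ->
  (forall m A, N m -> A `<=` above N m -> infinite_set A ->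
     exists B, [/\ B `<=` A, infinite_set B & Q m B]) ->
  exists L : set nat,
    [/\ L `<=` N, infinite_set L & forall m, L m -> Q m (above L m)].
Proof.
move=> Qanti infN dense.
(* A state pairs the last chosen element with the reservoir for later ones. *)
pose reservoir (A : set nat) := A `<=` N /\ infinite_set A.
pose good (p : nat * set nat) :=
  [/\ N p.1, reservoir p.2, p.2 `<=` above N p.1 & Q p.1 p.2].
have extend A : reservoir A ->
    exists2 p, good p & A p.1 /\ p.2 `<=` above A p.1.
  move=> [sAN infA]; have [m Am] := infinite_setN0 infA.
  have sAm : above A m `<=` above N m by move=> k [/sAN Nk].
  have [B [sBA infB QB]] := dense m _ (sAN m Am) sAm (infinite_above A m infA).
  exists (m, B) => //; split=> //=; first exact: sAN.
    by split=> // k /sBA [/sAN].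
  exact: subset_trans sBA sAm.
have step (p : {p | good p}) :
    {q : {p | good p} | (sval p).2 (sval q).1
                        /\ (sval q).2 `<=` above (sval p).2 (sval q).1}.
  apply: cid; case: p => p [Np rp sp Qp] /=.
  by have [q gq hq] := extend p.2 rp; exists (exist _ q gq).
have [p0 gp0 _] := extend N (conj (@subset_refl _ N) infN).
have [f [_ fS]] := dependent_choice step (exist _ p0 gp0).
pose x n := (sval (f n)).1; pose A n := (sval (f n)).2.
have Adecr i j : i <= j -> A j `<=` A i.
  elim: j => [|j IH]; first by rewrite leqn0 => /eqP->.
  rewrite leq_eqVlt => /orP[/eqP->//|/IH sAji].
  by apply: subset_trans sAji => k /(proj2 (fS j)) [].
have xA i j : i < j -> A i (x j).
  case: j => // j; rewrite ltnS => /Adecr; apply; exact: (proj1 (fS j)).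
have xlt i j : i < j -> x i < x j.
  by move=> /xA Aij; case: (svalP (f i)) => _ _ /(_ _ Aij) [].
have xlt' i j : x i < x j -> i < j.
  by case: (ltngtP i j) => // [/xlt|->]; [case: ltngtP|rewrite ltnn].
exists (range x); split.
- by move=> _ [n _ <-]; case: (svalP (f n)).
- move=> finx; apply: infinite_nat.
  rewrite -(preimage_range x); apply: finite_preimage finx => i j _ _ eqx.
  by case: (ltngtP i j) => // /xlt; rewrite eqx ltnn.
- move=> _ [i _ <-]; case: (svalP (f i)) => _ _ _; apply: Qanti.
  by move=> _ [[j _ <-] /xlt' /xA].
Qed.

Lemma fset_decomp_min (s : {fset nat}) : s <> fset0 ->
  exists m t, s = (m |` t)%fset /\ forall k, k \in t -> m < k.
Proof.
move=> /eqP/fset0Pn exs; case: (ex_minnP exs) => m ms min_m.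
exists m, (s `\ m)%fset; rewrite fsetD1K//; split=> // k.
by rewrite !inE => /andP[km /min_m]; rewrite leq_eqVlt eq_sym (negPf km).
Qed.

(** Membership of [C] in [G] over [L] can be tested link by link, by splitting
off the least element of each member of [C]. The links are those of the
ambient [M]; since [L] lies in [M], they contain the tails that arise. *)
Lemma sub_of_links (M L : set nat) (C G : set {fset nat}) :
  ~ C fset0 -> L `<=` M ->
  (forall m, L m -> link M C m `&` finsubsets (above L m)
                    `<=` [set t | G (m |` t)%fset]) ->
  C `&` finsubsets L `<=` G.
Proof.
move=> C0 sLM linkG s [Cs sL].
have [m [t [defs mt]]] : exists m t, s = (m |` t)%fset /\
    forall k, k \in t -> m < k.
  by apply: fset_decomp_min => s0; apply: C0; rewrite -s0.
subst s; have Lm : L m by apply: sL; rewrite /= fset1U1.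
have tL k : k \in t -> L k by move=> kt; apply: sL; rewrite /= fset1Ur.
apply: (linkG m Lm); split; last by move=> k kt; split; [exact: tL|exact: mt].
by split=> // k kt; apply/sLM/tL.
Qed.

(** The inductive step: diagonalise over the links, then apply the pigeonhole
principle to the side on which each link falls. *)
Lemma ramsey_on_links (M : set nat) (C : set {fset nat}) :
  ~ C fset0 ->
  (forall m, M m -> ramsey_on (above M m) (link M C m)) ->
  ramsey_on M C.
Proof.
move=> C0 ramseyC F N sNM infN.
pose Fm m : set {fset nat} := [set t | F (m |` t)%fset].
have [D [sDN infD homD]] : exists D : set nat, [/\ D `<=` N, infinite_set D &
    forall m, D m -> homogeneous (link M C m) (Fm m) (above D m)].
  apply: (@diagonal_intersection
    (fun m => homogeneous (link M C m) (Fm m))) => // [m A B|m A Nm sAN infA].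
    exact: homogeneousS.
  apply: ramseyC => //; first exact: sNM.
  by move=> k /sAN [/sNM Mk].
pose inF m := link M C m `&` finsubsets (above D m) `<=` Fm m.
have sublink (A : set nat) m : A `<=` D ->
    link M C m `&` finsubsets (above A m)
    `<=` link M C m `&` finsubsets (above D m).
  by move=> sAD t [lt tA]; split=> // k /tA [/sAD].
have sDM : D `<=` M := subset_trans sDN sNM.
have : infinite_set (D `&` [set m | inF m]) \/
       infinite_set (D `&` [set m | ~ inF m]).
  apply/not_andP => -[fin1 fin2]; apply: infD.
  by rewrite -(setIT D) -(setUv [set m | inF m]) setIUr finite_setU.
move=> [infL|infL].
- exists (D `&` [set m | inF m]); split=> //; first by move=> k [/sDN].
  left; apply: (@sub_of_links M) => // [k [/sDM]|m [Dm hm]]; first by [].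
  by apply: subset_trans (sublink _ m _) hm => k [].
- exists (D `&` [set m | ~ inF m]); split=> //; first by move=> k [/sDN].
  right; apply: (@sub_of_links M) => // [k [/sDM]|m [Dm hm]]; first by [].
  case: (homD m Dm) => // hm'.
  by apply: subset_trans (sublink _ m _) hm' => k [].
Qed.

(** For rank zero the family is the singleton of the empty set, so every set is
homogeneous. *)
Lemma uniform_ramsey (d : Order.disp_t) (W : orderType d) (xi : W)
    (M : set nat) (C : set {fset nat}) :
  uniform xi M C -> ramsey_on M C.
Proof.
elim=> {xi M C} [xi M _ _ -> F N _ infN|xi zeta M C _ C0 _ IH|
                 xi x M C _ C0 _ _ _ _ IH].
- exists N; split=> //.
  by have [F0|F0] := pselect (F fset0); [left|right] => s [->].
- exact: ramsey_on_links.
- exact: ramsey_on_links.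
Qed.

Theorem theoremA (F : set {fset nat}) (hF : F `<=` finsubsets posnat)
    (d : Order.disp_t) (W : orderType d) (hW : well_ordered_type W)
    (xi : W) (hxi : countable_ordinal xi)
    (M : set nat) (hM : M `<=` posnat) (infM : infinite_set M)
    (calL : set {fset nat}) (hL : calL `<=` finsubsets M)
    (unifL : uniform xi M calL) :
  exists L : set nat,
    [/\ L `<=` M, infinite_set L
      & calL `&` finsubsets L `<=` F \/
        calL `&` finsubsets L `<=` finsubsets M `\` F].
Proof.
have ramseyL := uniform_ramsey _ _ _ _ _ unifL.
have [L [sLM infL homL]] := ramseyL F M (@subset_refl _ M) infM.
exists L; split=> //; case: homL => [inF|notF]; [by left|right].
by move=> s [Cs sL]; split; [exact: hL|exact: notF].
Qed.
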